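(* Let $n\geq 3$ and consider the run, for this $n$, of the following recursive search procedure started from $(p,s,i)=(1,0,0)$ and the empty candidate. The procedure, called with $(p,s,i)$ and candidate $(a_1,\dots,a_i)$, lets $m:=a_i$ if $i\geq1$ and $m:=n$ if $i=0$; for each $a'=2,\dots,m$ it sets $a_{i+1}:=a'$, $s':=s+a'$, $p':=pa'$, $i':=i+1$, and: if $p'>s'+n-i'$ it discards $a'$; if $p'=s'+n-i'$ it records $(a_1,\dots,a_{i'},1,\dots,1)\in\mathbb N^n$ as a solution; if $p'<s'+n-i'$ it calls itself recursively with $(p',s',i')$ and candidate $(a_1,\dots,a_{i'})$. Call a step of this run at which $p'<s'+n-i'$ a feasible step. Then: (1) At every feasible step, with $n':=p'-s'+i'$, one has $i'\leq n'<n$, and the sequence $\widetilde a=(a_1,\dots,a_i,a',1,\dots,1)\in\mathbb N^{n'}$ satisfies $\prod_{j=1}^{n'}\widetilde a_j=\sum_{j=1}^{n'}\widetilde a_j$. (2) For every $n'<n$, every non-increasing positive integer solution of $\prod_{j=1}^{n'} a_j=\sum_{j=1}^{n'} a_j$ arises in this way from some feasible step of the run. (3) No solution arises from two different feasible steps; that is, the correspondence in (1) is injective.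
   Context: All sequences are of positive integers and non-increasing. $\mathbb N$ denotes the positive integers.
   Formalization: In (2), for n'=1 only the solutions (a) with 2≤a≤n are claimed to arise: every one-term sequence satisfies product = sum, but the run yields only (2),…,(n), so (1) and (a) with a>n never arise. *)

(* Defs.v *)
From HB Require Import structures.
From mathcomp Require Import all_boot all_order all_algebra.
From mathcomp Require Import zify.

Set Implicit Arguments.
Unset Strict Implicit.
Unset Printing Implicit Defensive.

Import Order.TTheory GRing.Theory Num.Theory.

(* A call of the procedure: its arguments (p, s, i) and the candidate
   (a_1, ..., a_i), stored 0-based, so that a_i is [nth 0 c i.-1]. *)
Record call := Call {
  call_p : nat;
  call_s : nat;
  call_i : nat;
  call_cand : seq nat }.

Definition init_call : call := Call 1 0 0 [::].

Definition upper (n : nat) (c : call) : nat :=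
  if call_i c is i.+1 then nth 0 (call_cand c) i else n.

Definition choices (n : nat) (c : call) : seq nat := index_iota 2 (upper n c).+1.

Record step := Step { step_call : call; step_choice : nat }.

(* The primed quantities (p', s', i') and the extended candidate. *)
Definition extend (st : step) : call :=
  let: Step (Call p s i c) a' := st in Call (p * a') (s + a') i.+1 (rcons c a').

Definition p' (st : step) : nat := call_p (extend st).
Definition s' (st : step) : nat := call_s (extend st).
Definition i' (st : step) : nat := call_i (extend st).

(* Comparisons and n' are taken in int: subtraction on nat is truncated. *)
Definition threshold (n : nat) (st : step) : int :=
  ((s' st)%:Z + n%:Z - (i' st)%:Z)%R.

Variant outcome := Discard | Record_solution of seq nat | Recurse.

Definition step_outcome (n : nat) (st : step) : outcome :=
  if (threshold n st < (p' st)%:Z)%R then Discard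
  else if ((p' st)%:Z == threshold n st)%R then
    Record_solution (call_cand (extend st) ++ nseq (n - i' st) 1)
  else Recurse.

Definition feasible (n : nat) (st : step) : Prop :=
  ((p' st)%:Z < threshold n st)%R.

(* [exec n c l tr]: executing, inside the call [c], the loop over the remaining
   values [l] of a' terminates, and [tr] lists in chronological order all the
   steps performed, including those of the nested calls. *)
Inductive exec (n : nat) (c : call) : seq nat -> seq step -> Prop :=
| exec_done : exec n c [::] [::]
| exec_discard a' l tr :
    step_outcome n (Step c a') = Discard ->
    exec n c l tr ->
    exec n c (a' :: l) (Step c a' :: tr)
| exec_record a' l sol tr :
    step_outcome n (Step c a') = Record_solution sol ->
    exec n c l tr ->
    exec n c (a' :: l) (Step c a' :: tr)
| exec_recurse a' l tr1 tr2 :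
    step_outcome n (Step c a') = Recurse ->
    exec n (extend (Step c a')) (choices n (extend (Step c a'))) tr1 ->
    exec n c l tr2 ->
    exec n c (a' :: l) (Step c a' :: tr1 ++ tr2).

Definition is_run (n : nat) (tr : seq step) : Prop :=
  exec n init_call (choices n init_call) tr.

Definition n' (st : step) : int := ((p' st)%:Z - (s' st)%:Z + (i' st)%:Z)%R.

Definition tilde (st : step) : seq nat :=
  call_cand (extend st) ++ nseq (`|n' st|%N - i' st) 1.

Definition is_solution (k : nat) (a : seq nat) : Prop :=
  [/\ size a = k, all (leq 1) a, sorted geq a &
      \prod_(x <- a) x = \sum_(x <- a) x].

Lemma feasibleE n st : feasible n st <-> step_outcome n st = Recurse.
Proof.
rewrite /feasible /step_outcome; split.
  by move=> h; rewrite ltNge (ltW h) /= (lt_eqF h).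
by case: ltgtP.
Qed.

Lemma exec_fun n c l tr1 tr2 : exec n c l tr1 -> exec n c l tr2 -> tr1 = tr2.
Proof.
move=> h; elim: h tr2 => {c l tr1}.
- by move=> c tr2 h; inversion h.
- move=> c a l tr e _ IH tr2 h; inversion h; subst; try congruence.
  by congr cons; apply: IH.
- move=> c a l sol tr e _ IH tr2 h; inversion h; subst; try congruence.
  by congr cons; apply: IH.
- move=> c a l t1 t2 e _ IH1 _ IH2 tr2 h; inversion h; subst; try congruence.
  by congr (_ :: _ ++ _); [apply: IH1 | apply: IH2].
Qed.

(* The run exists (the procedure terminates) and is unique. *)
Lemma exec_total n d c l :
  (c = init_call \/ 2 <= call_p c /\ call_s c <= call_p c) ->
  n <= call_i c + d -> all (leq 2) l -> exists tr, exec n c l tr.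
Proof.
elim: d c l => [|d IHd] c l hc hn.
all: elim: l => [|a l IHl] /=; first by exists [::]; constructor.
all: case/andP=> ha /IHl [tr htr].
all: have hinv : 2 <= p' (Step c a) /\ s' (Step c a) <= p' (Step c a).
1,3: case: hc => [->|]; first by rewrite /p' /s' /=; lia.
1,2: by case: (c) => p s i b; rewrite /p' /s' /=; nia.
all: have hi : i' (Step c a) = (call_i c).+1 by case: (c).
all: case e: (step_outcome n (Step c a)) => [|sol|].
1,4: by exists (Step c a :: tr); apply: exec_discard.
1,3: by exists (Step c a :: tr); apply: exec_record e htr.
  by move/feasibleE: e; rewrite /feasible /threshold hi; lia.
have [||| tr1 h1] := IHd (extend (Step c a)) (choices n (extend (Step c a))).
- by right.
- by rewrite -/(i' _) hi addSnnS.
- by apply/allP=> x; rewrite mem_index_iota => /andP[].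
by exists (Step c a :: tr1 ++ tr); apply: exec_recurse.
Qed.

Lemma is_run_exists_unique n : exists! tr, is_run n tr.
Proof.
have [|||tr htr] := @exec_total n n init_call (choices n init_call).
- by left.
- by [].
- by apply/allP=> x; rewrite mem_index_iota => /andP[].
- by exists tr; split=> // tr2; apply: exec_fun.
Qed.

(* Main.v *)
Require Import Defs.
From mathcomp Require Import all_boot all_order all_algebra.
From mathcomp Require Import zify.

(* The arguments of a call are determined by its candidate w: p is the product,
   s the sum and i the length of w.  Since
   [p * a - (s + a) + (i + 1) = (p - s + i) + (p - 1) * (a - 1)],
   the quantity p - s + i does not decrease when w is extended, so every prefix
   of a feasible candidate is feasible and the run reaches each feasible
   candidate exactly once.  Padding w with n' - i' ones makes sum and product
   agree, and w is recovered by deleting the ones. *)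

Definition call_of (w : seq nat) : call :=
  Call (\prod_(x <- w) x) (\sum_(x <- w) x) (size w) w.

Definition word (st : step) : seq nat := call_cand (extend st).

(** The inequality [p < s + n - i] with [i] moved to the left, so that truncated subtraction on
    [nat] never enters. *)
Definition feasible_word (n : nat) (w : seq nat) : bool :=
  \prod_(x <- w) x + size w < \sum_(x <- w) x + n.

Lemma extend_call_of w a : extend (Step (call_of w) a) = call_of (rcons w a).
Proof. by rewrite /call_of /= !big_rcons /= size_rcons mulnC addnC. Qed.

Lemma choices_rcons n w a :
  choices n (call_of (rcons w a)) = index_iota 2 a.+1.
Proof. by rewrite /choices /upper /= size_rcons nth_rcons ltnn eqxx. Qed.

Lemma feasible_call_of n st w :
  extend st = call_of w -> feasible n st <-> feasible_word n w.
Proof.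
by rewrite /feasible /threshold /p' /s' /i' /feasible_word => -> /=; split; lia.
Qed.

Lemma step_outcome_call_of n w a :
  step_outcome n (Step (call_of w) a) = Recurse <->
  feasible_word n (rcons w a).
Proof.
by rewrite -feasibleE; apply: feasible_call_of; rewrite extend_call_of.
Qed.

Lemma prod_gt0 (w : seq nat) : all (leq 2) w -> 0 < \prod_(x <- w) x.
Proof.
elim: w => [|a w IH] /=; first by rewrite big_nil.
by case/andP=> ha /IH h; rewrite big_cons muln_gt0 h (ltnW ha).
Qed.

(** The lower bound on the product is carried through the induction because [a + p <= a * p] uses
    that both factors are at least 2. *)
Lemma sum_le_prod (w : seq nat) : all (leq 2) w -> w != [::] ->
  2 <= \prod_(x <- w) x /\ \sum_(x <- w) x <= \prod_(x <- w) x.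
Proof.
elim: w => [//|a [|b w] IH] /= /andP[ha hw] _; first by rewrite !big_seq1.
by have [] := IH hw isT; rewrite (big_cons _ _ a) [X in _ /\ X <= _]big_cons; nia.
Qed.

Lemma feasible_word_prefix n w r :
  all (leq 2) (w ++ r) -> feasible_word n (w ++ r) -> feasible_word n w.
Proof.
elim/last_ind: r => [|r a IH]; first by rewrite cats0.
rewrite -rcons_cat all_rcons => /andP[ha hw] hf; apply: IH => //.
have := prod_gt0 _ hw; move: hf.
by rewrite /feasible_word !big_rcons /= size_rcons; nia.
Qed.

(** The second clause drives the third: words from different iterations of one loop differ in the
    letter right after [w]. *)
Lemma exec_words n w l tr : exec n (call_of w) l tr ->
  [/\ map extend tr = map call_of (map word tr),
      forall v, v \in map word tr -> exists a r,
        [/\ v = w ++ a :: r, a \in l, all (leq 2) r & sorted geq (a :: r)]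
    & uniq l -> uniq (map word tr)].
Proof.
(* The call is made a variable so that the induction hypothesis applies to nested calls, whose
   candidate is longer than [w]. *)
move=> h; have [c ec] : exists c, c = call_of w by eexists.
rewrite -ec in h; elim: h w ec => {c l tr} [c|c a l tr e _ IH|c a l sol tr e _ IH
  |c a l t1 t2 e _ IH1 _ IH2] w ec; subst c.
- by [].
1,2: have [IHe IHm IHu] := IH w erefl.
1,2: have ew : word (Step (call_of w) a) = rcons w a by rewrite /word extend_call_of.
1,2: split; rewrite (map_cons word) ew.
1,4: by rewrite (map_cons extend) extend_call_of IHe.
1,3: move=> v; rewrite inE => /orP[/eqP->|/IHm[b [r [-> hb hr hs]]]].
1,3: by exists a, [::]; rewrite cats1 mem_head.
1,2: by exists b, r; rewrite inE hb orbT.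
1,2: move=> /= /andP[ha hl]; rewrite (IHu hl) andbT; apply/negP=> /IHm[b [r [/eqP]]].
1,2: by rewrite -cats1 eqseq_cat // eqxx => /eqP[<-] _; rewrite (negbTE ha).
have [IHe2 IHm2 IHu2] := IH2 w erefl.
have ex : extend (Step (call_of w) a) = call_of (rcons w a) by exact: extend_call_of.
have [IHe1 IHm1 IHu1] := IH1 (rcons w a) ex.
rewrite ex choices_rcons in IHm1 IHu1.
have ew : word (Step (call_of w) a) = rcons w a by rewrite /word ex.
split; rewrite (map_cons word) ew map_cat.
- by rewrite (map_cons extend) ex map_cat IHe1 IHe2 /= map_cat.
- move=> v; rewrite inE mem_cat => /or3P[/eqP->|/IHm1|/IHm2].
  + by exists a, [::]; rewrite cats1 mem_head.
  (* The nested loop stops at [a], hence [b <= a], which extends sortedness by one letter. *)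
  + case=> b [r [-> hb hr hs]]; move: hb; rewrite mem_index_iota => /andP[hb hba].
    exists a, (b :: r); rewrite cat_rcons mem_head; split=> //=.
      by rewrite hb.
    by apply/andP; split.
  + by case=> b [r [-> hb hr hs]]; exists b, r; rewrite inE hb orbT.
move=> /= /andP[ha hl]; rewrite cat_uniq (IHu2 hl) IHu1 ?iota_uniq // andbT /=.
(* Nested words are strictly longer than [rcons w a]; words of later iterations continue [w] by a
   letter of [l], which does not contain [a]. *)
rewrite mem_cat negb_or -!andbA; apply/and3P; split.
- apply/negP=> /IHm1[b [r [/eqP]]].
  by rewrite -[X in X == _]cats0 eqseq_cat // andbF.
- apply/negP=> /IHm2[b [r [/eqP]]].
  by rewrite -cats1 eqseq_cat // eqxx => /eqP[<-] _; rewrite (negbTE ha).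
- apply/hasPn=> v /IHm2[b [r [-> hb _ _]]]; apply/negP=> /IHm1[d [q [/eqP]]].
  by rewrite cat_rcons eqseq_cat // eqxx => /eqP[e1 _]; rewrite -e1 hb in ha.
Qed.

(** The prefix [rcons w a] is itself feasible, so the run neither discards nor records it but
    recurses; sortedness puts the next letter within the nested range. *)
Lemma exec_complete n w l tr a r : exec n (call_of w) l tr ->
  all (leq 2) (w ++ a :: r) -> a \in l -> sorted geq (a :: r) ->
  feasible_word n (w ++ a :: r) -> w ++ a :: r \in map word tr.
Proof.
move=> h; have [c ec] : exists c, c = call_of w by eexists.
rewrite -ec in h; elim: h w a r ec => {c l tr} [c|c b l tr e _ IH|c b l sol tr e _ IH
  |c b l t1 t2 e _ IH1 _ IH2] w a r ec hw hl hs hf; subst c.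
- by [].
1,2: move: hl; rewrite inE => /orP[/eqP eab|hl]; last by rewrite inE IH ?orbT.
1,2: suff: step_outcome n (Step (call_of w) b) = Recurse by rewrite e.
1,2: rewrite -eab; apply/step_outcome_call_of.
1,2: by rewrite -cat_rcons in hw hf; apply: feasible_word_prefix hf.
move: hl; rewrite (map_cons word) map_cat !in_cons mem_cat.
move=> /orP[/eqP eab|hl]; last by rewrite (IH2 w a r) ?orbT.
have ex : extend (Step (call_of w) b) = call_of (rcons w b) by exact: extend_call_of.
rewrite /word ex /=; case: r => [|d r] in hw hs hf *.
  by rewrite cats1 eab eqxx.
rewrite -cat_rcons eab (IH1 (rcons w b) d r) ?orbT //.
- by rewrite -eab cat_rcons.
- rewrite ex choices_rcons mem_index_iota -eab ltnS.
  move: hs hw => /= /andP[hda _]; rewrite all_cat /= => /and4P[_ _ hd _].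
  by rewrite hd.
- by case/andP: hs.
- by rewrite -eab cat_rcons.
Qed.

Lemma prod_pad_ones (w : seq nat) m :
  \prod_(x <- w ++ nseq m 1) x = \prod_(x <- w) x.
Proof. by rewrite big_cat /= [X in _ * X]big_nseq iter_fix // muln1. Qed.

Lemma sum_pad_ones (w : seq nat) m :
  \sum_(x <- w ++ nseq m 1) x = \sum_(x <- w) x + m.
Proof. by rewrite big_cat /= [X in _ + X]big_nseq iter_addn_0 mul1n. Qed.

Lemma filter_pad_ones (w : seq nat) m :
  all (leq 2) w -> filter (leq 2) (w ++ nseq m 1) = w.
Proof.
by move=> hw; rewrite filter_cat filter_nseq cats0; apply/all_filterP.
Qed.

Lemma sorted_pad_ones (w : seq nat) m :
  all (leq 2) w -> sorted geq w -> sorted geq (w ++ nseq m 1).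
Proof.
have h1 x : 1 <= x -> path geq x (nseq m 1).
  by elim: m x => //= m IH x ->; apply: IH.
case: w => [|a w] /=; first by case: m h1 => //= m h1 _ _; have /andP[] := h1 1 isT.
move=> hw hs; rewrite cat_path hs h1 //.
have /allP/(_ _ (mem_last a w)) : all (leq 2) (a :: w) by [].
exact: ltnW.
Qed.

(** In a non-increasing positive sequence everything after the first 1 is again 1. *)
Lemma solution_pad_ones (a : seq nat) : all (leq 1) a -> sorted geq a ->
  a = filter (leq 2) a ++ nseq (size a - size (filter (leq 2) a)) 1.
Proof.
elim: a => [//|x a IH] /= /andP[hx ha] hs.
have {}IH := IH ha (path_sorted hs).
case: ifP => hx2; first by rewrite /= subSS -IH.
have ea : a = nseq (size a) 1.
  apply/all_pred1P/allP=> y ya /=; rewrite eqn_leq (allP ha) // andbT.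
  have tr : transitive geq by move=> u v z /= h1 h2; exact: leq_trans h2 h1.
  have /= := allP (order_path_min tr hs) y ya; lia.
have -> : filter (leq 2) a = [::] by rewrite ea filter_nseq.
have -> : x = 1 by lia.
by rewrite subn0 /= -ea.
Qed.

Lemma run_words n tr : is_run n tr ->
  [/\ forall j st, onth tr j = Some st ->
        [/\ extend st = call_of (word st), all (leq 2) (word st),
            word st != [::] & sorted geq (word st)],
      forall w, all (leq 2) w -> w != [::] -> sorted geq w -> head 0 w <= n ->
        feasible_word n w -> w \in map word tr
    & uniq (map word tr)].
Proof.
have -> : is_run n tr = exec n (call_of [::]) (index_iota 2 n.+1) tr.
  by rewrite /is_run /call_of !big_nil.
move=> h; have [he hm hu] := exec_words _ _ _ _ h; split.
- move=> j st hj; have hw : word st \in map word tr.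
    by apply/onthP; exists j; rewrite onth_map hj.
  have [a [r [ew ha hr hs]]] := hm _ hw; rewrite ew.
  split=> //.
    have := congr1 (fun u => onth u j) he.
    by rewrite !onth_map hj /= ew => -[].
  by move: ha => /=; rewrite mem_index_iota hr andbT => /andP[].
- case=> [//|a w] hw _ hs hn hf; apply: (exec_complete _ [::] _ _ a w h) => //.
  by rewrite mem_index_iota ltnS hn andbT; case/andP: hw.
- by apply: hu; rewrite iota_uniq.
Qed.

Theorem theorem2p3 (n : nat) (hn : 3 <= n) (tr : seq step) (htr : is_run n tr) :
  (forall (j : nat) (st : step),
     onth tr j = Some st -> feasible n st ->
     ((i' st)%:Z <= n' st)%R /\ (n' st < n%:Z)%R /\
     is_solution `|n' st|%N (tilde st))
  /\
  (forall (k : nat) (a : seq nat),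
     k < n -> is_solution k a ->
     (k = 1 -> 2 <= head 0 a <= n) ->
     exists (j : nat) (st : step),
       [/\ onth tr j = Some st, feasible n st, n' st = (k%:Z)%R & tilde st = a])
  /\
  (forall (j1 j2 : nat) (st1 st2 : step),
     onth tr j1 = Some st1 -> feasible n st1 ->
     onth tr j2 = Some st2 -> feasible n st2 ->
     tilde st1 = tilde st2 -> j1 = j2).
Proof.
have [hst hcomp hu] := run_words _ _ htr; split; [|split].
- move=> j st hj; have [ex h2 h0 hs] := hst _ _ hj.
  move/(feasible_call_of _ _ _ ex); have [_ hle] := sum_le_prod _ h2 h0.
  rewrite /feasible_word /is_solution /tilde /n' /p' /s' /i' ex /= => hf.
  (* [i' <= n'] amounts to sum at most product ([hle]), and [n' < n] is feasibility rearranged. *)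
  split; first lia.
  split; first lia.
  rewrite prod_pad_ones sum_pad_ones size_cat size_nseq sorted_pad_ones //.
  split=> //; try lia.
  rewrite all_cat all_nseq orbT andbT.
  by apply/allP=> x /(allP h2)/ltnW.
- move=> k a hk [hsz h1 hs hps] hk1.
  have ea := solution_pad_ones _ h1 hs.
  set w := filter _ a in ea; set m := size a - _ in ea.
  have h2 : all (leq 2) w by apply: filter_all.
  have hsw : size w + m = k by rewrite -hsz ea size_cat size_nseq.
  have hws : sorted geq w.
    by apply: sorted_filter hs => u v z /= e1 e2; apply: leq_trans e2 e1.
  have hpw : \prod_(x <- w) x = \sum_(x <- w) x + m.
    by move: hps; rewrite ea prod_pad_ones sum_pad_ones.
  (* Since the product is the sum plus [m], feasibility becomes [size w + m < n], that is
     [k < n]. *)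
  have hf : feasible_word n w by rewrite /feasible_word hpw; lia.
  (* An empty [w] would force [m = k = 1] and [a = [:: 1]], against the lower bound in [hk1]. *)
  have h0 : w != [::].
    apply/eqP=> ew; move: hpw hsw; rewrite ew !big_nil /= => hm hkm.
    have em : m = 1 by lia.
    by have := hk1 ltac:(lia); rewrite ea ew em.
  (* For a single letter [m = 0] and [k = 1], so [hk1] bounds it. Otherwise the feasible prefix
     [[:: x; y]] gives [(x - 1) * (y - 1) < n - 1] with [y >= 2], hence [x < n]. *)
  have hhead : head 0 w <= n.
    case ew: w => [//|x [|y r]] /=.
      move: hpw hsw; rewrite ew !big_seq1 /= => hm hkm.
      by have := hk1 ltac:(lia); rewrite ea ew /= => /andP[].
    rewrite ew -[x :: _]/([:: x; y] ++ r) in h2 hf.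
    have := feasible_word_prefix _ _ _ h2 hf.
    move: h2 => /= /and3P[hx hy _].
    by rewrite /feasible_word !big_cons !big_nil /=; nia.
  have /onthP[j] := hcomp _ h2 h0 hws hhead hf.
  rewrite onth_map; case hj: (onth tr j) => [st|//] /= -[ew].
  have [ex _ _ _] := hst _ _ hj; rewrite ew in ex.
  have en : n' st = k%:Z%R by rewrite /n' /p' /s' /i' ex /=; lia.
  exists j, st; split=> //; first exact/(feasible_call_of _ _ _ ex).
  by rewrite /tilde en /i' ex /= ea -hsw addKn.
- move=> j1 j2 st1 st2 hj1 _ hj2 _ et.
  have [_ h1 _ _] := hst _ _ hj1; have [_ h2 _ _] := hst _ _ hj2.
  (* Words occur without repetition along the run, so equal words give equal positions; deleting the
     ones from [tilde] recovers the word. *)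
  apply: (onth_inj _ _ _ hu); last rewrite !onth_map hj1 hj2 /=.
    by rewrite gtn_min -!onthTE !onth_map hj1 hj2.
  rewrite -(filter_pad_ones _ (`|n' st1| - i' st1) h1) -/(tilde st1) et.
  by rewrite filter_pad_ones.
Qed.
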